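(* Let $\pi$ be a graphic sequence with $n$ terms, each at most $n/24$, such that $\pi+\mathbf{1}$ is graphic. Let $(G,\mathcal{I})$ and $(G',\mathcal{J})$ be Kundu realizations of $\pi+\mathbf{1}$. Then it is possible to transform $(G,\mathcal{I})$ into $(G',\mathcal{J})$ by a finite sequence of swap operations via Kundu realizations of $\pi+\mathbf{1}$, where in each step the image of the displayed 1-factor is the next displayed 1-factor; that is, there is a finite sequence of K-swaps transforming $(G,\mathcal{I})$ into $(G',\mathcal{J})$.
   Context: All graphs are simple, on $V=\{v_1,\dots,v_n\}$. A sequence $\pi=(d_1,\dots,d_n)$ (not assumed ordered) is graphic if some simple graph $G$ on $V$ has $d_G(v_i)=d_i$ for all $i$; $G$ is then a realization of $\pi$. $\mathbf{1}$ is the all-ones sequence of length $n$; sums of sequences are componentwise. A 1-factor on $V$ is a perfect matching of the complete graph on $V$. A Kundu realization of $\pi+\mathbf{1}$ is a pair $(G,\mathcal{I})$ where $G$ is a realization of $\pi$ on $V$ and $\mathcal{I}$ is a 1-factor on $V$ edge-disjoint from $G$; $\mathcal{I}$ is its displayed 1-factor. A swap $ab,cd\Rightarrow bc,ad$ on a graph $H$ with edge set $E$, where $a,b,c,d$ are distinct vertices with $ab,cd\in E$ and $bc,ad\notin E$, replaces $E$ by $(E\cup\{bc,ad\})\setminus\{ab,cd\}$. A K-swap (Kundu-restricted swap) on a Kundu realization $(G,\mathcal{I})$ is a swap $ab,cd\Rightarrow bc,ad$ on the graph $G\cup\mathcal{I}$ (so $bc,ad\notin E(G)\cup\mathcal{I}$)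 such that either $\{ab,cd\}\subset\mathcal{I}$ or $\{ab,cd\}\cap\mathcal{I}=\emptyset$. In the first case the image of the displayed 1-factor is $\mathcal{I}'=(\mathcal{I}\cup\{bc,ad\})\setminus\{ab,cd\}$ and $G$ is unchanged; in the second case $\mathcal{I}$ is unchanged and $E(G)$ becomes $(E(G)\cup\{bc,ad\})\setminus\{ab,cd\}$. The result is again a Kundu realization. *)

(* Defs.v *)
From mathcomp Require Import all_boot.

Set Implicit Arguments.
Unset Strict Implicit.
Unset Printing Implicit Defensive.

Section KunduRealizations.

Variable n : nat.

(* A simple graph on the vertex set 'I_n is given by its edge set: a set of
   2-element sets of vertices. *)
Notation edges := {set {set 'I_n}}.

Definition simple_graph (E : edges) : bool := [forall e in E, #|e| == 2].

Definition degree (E : edges) (v : 'I_n) : nat := #|[set e in E | v \in e]|.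

Definition realization (pi : 'I_n -> nat) (E : edges) : bool :=
  simple_graph E && [forall v, degree E v == pi v].

Definition graphic (pi : 'I_n -> nat) : Prop := exists E, realization pi E.

Definition ones : 'I_n -> nat := fun=> 1.

Definition add_seq (p q : 'I_n -> nat) : 'I_n -> nat := fun i => p i + q i.

(* A perfect matching of the complete graph: pairwise disjoint edges covering
   all the vertices. *)
Definition one_factor (I : edges) : bool :=
  simple_graph I && partition I [set: 'I_n].

(* [kundu_realization pi (G, I)]: the pair (G, I) is a Kundu realization of
   pi + 1; the parameter is pi itself, not pi + 1. *)
Definition kundu_realization (pi : 'I_n -> nat) (K : edges * edges) : bool :=
  [&& realization pi K.1, one_factor K.2 & [disjoint K.1 & K.2]].

Definition swappable (a b c d : 'I_n) (E : edges) : bool :=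
  [&& uniq [:: a; b; c; d],
      [set a; b] \in E, [set c; d] \in E,
      [set b; c] \notin E & [set a; d] \notin E].

Definition swap (a b c d : 'I_n) (E : edges) : edges :=
  (E :|: [set [set b; c]; [set a; d]]) :\: [set [set a; b]; [set c; d]].

(* The two cases of a K-swap are exclusive; a swap removing one edge of the
   displayed 1-factor and one edge of G is not allowed. *)
Definition kswap_at (a b c d : 'I_n) (K K' : edges * edges) : bool :=
  let removed := [set [set a; b]; [set c; d]] in
  swappable a b c d (K.1 :|: K.2) &&
  ((removed \subset K.2) && (K' == (K.1, swap a b c d K.2))
   || [disjoint removed & K.2] && (K' == (swap a b c d K.1, K.2))).

Definition kswap : rel (edges * edges) := fun K K' =>
  [exists a, exists b, exists c, exists d, kswap_at a b c d K K'].

End KunduRealizations.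

Arguments ones {n}.

(* Main.v *)
Require Import Defs.
From mathcomp Require Import all_boot.
From mathcomp Require Import zify.

Set Implicit Arguments.
Unset Strict Implicit.
Unset Printing Implicit Defensive.

(** Changing the graph and changing the 1-factor can be treated separately,
because every vertex has very few neighbours compared with n.

Any two realizations of the same degree sequence are joined by ordinary swaps
([realizations_connected]). Colour the edges of G outside G' red and those of
G' outside G blue, so that red and blue degrees agree at every vertex. A path
with colours red, blue, red gives a swap in G or in G' that brings the two
graphs closer, unless its ends are joined by a red edge, and likewise with the
colours exchanged. If there were no such swap, a vertex of maximal red degree
would spread its red edges so much that some edge would be both red and blue.

A swap of G into G1 is a K-swap as soon as the displayed 1-factor avoids the
two edges that it creates. The 1-factor can be moved off G and G1 beforehand
([avoid_graph]): an offending edge pq is exchanged with an edge zw of the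
1-factor such that neither pz nor qw is an edge of G or G1, and most edges of
the 1-factor have this property.

It remains to join two 1-factors I and J avoiding the same G
([matchings_connected]). To put an edge xy of J in I, with partners x' and y'
in I, one swaps xx' and yy' for xy and x'y'. This is blocked only if x'y' is
an edge of G; then an edge zw of I away from all the neighbourhoods involved
serves as a go-between: three swaps put two edges of J in I and remove at most
one, namely zw. *)

(** * Graphs as sets of two-element sets *)

Lemma set2_eq (T : finType) (a b c d : T) :
  ([set a; b] == [set c; d]) = (a == c) && (b == d) || (a == d) && (b == c).
Proof.
apply/eqP/idP => [E|]; last first.
  by case/orP=> /andP[/eqP-> /eqP->] //; rewrite setUC.
have: [&& a \in [set c; d], b \in [set c; d], c \in [set a; b] & d \in [set a; b]].
  by apply/and4P; split; [rewrite -E|rewrite -E|rewrite E|rewrite E];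
    rewrite !inE eqxx ?orbT.
rewrite !inE ![c == _]eq_sym ![d == _]eq_sym.
by do !case: (_ == _) => //.
Qed.

(** Counts the progress of a step that settles two edges at the cost of
unsettling at most one. *)
Lemma card_exchange (T : finType) (X Y : {set T}) (e f g : T) :
  e \in X -> f \in X -> e != f -> Y \subset g |: (X :\ e :\ f) -> #|Y| < #|X|.
Proof.
move=> eX fX nef /subset_leq_card leY.
rewrite (cardsD1 e X) eX (cardsD1 f (X :\ e)) !inE eq_sym nef fX /=.
by apply: (leq_ltn_trans leY); rewrite cardsU1; case: (_ \notin _); lia.
Qed.

Lemma connect_closed (T : finType) (e : rel T) (P : pred T) (x y : T) :
  (forall u v : T, e u v -> P u -> P v) -> connect e x y -> P x -> P y.
Proof.
move=> eP /connectP[s es ->]; elim: s x es => //= z s IH x /andP[exz es] Px.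
exact: IH es (eP _ _ exz Px).
Qed.

Section Graphs.

Variable n : nat.
Notation edges := {set {set 'I_n}}.
Implicit Types (E G H I J : edges) (a b c d u v w x y z : 'I_n).

Definition nbrs E v : {set 'I_n} := [set w | [set v; w] \in E].

Lemma in_nbrs E v w : (w \in nbrs E v) = ([set v; w] \in E).
Proof. by rewrite inE. Qed.

Lemma nbrs_sym E v w : (w \in nbrs E v) = (v \in nbrs E w).
Proof. by rewrite !in_nbrs setUC. Qed.

Lemma simple_edge E e :
  simple_graph E -> e \in E -> exists u v, u != v /\ e = [set u; v].
Proof.
move=> /forall_inP sE eE; have /cards2P[u [v [nuv ->]]] := sE _ eE.
by exists u, v.
Qed.

Lemma edge_neq E u v : simple_graph E -> [set u; v] \in E -> u != v.
Proof.
move=> /forall_inP sE /sE; apply: contraTneq => ->.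
by rewrite setUid cards1.
Qed.

Lemma simple_ext E E' :
  simple_graph E -> simple_graph E' -> nbrs E =1 nbrs E' -> E = E'.
Proof.
move=> sE sE' eqnb.
have eqE u v : ([set u; v] \in E) = ([set u; v] \in E') by rewrite -!in_nbrs eqnb.
apply/setP=> e; apply/idP/idP=> eE.
  by have [u [v [_ e_uv]]] := simple_edge sE eE; rewrite e_uv -eqE -e_uv.
by have [u [v [_ e_uv]]] := simple_edge sE' eE; rewrite e_uv eqE -e_uv.
Qed.

Lemma card_nbrs E v : simple_graph E -> #|nbrs E v| = degree E v.
Proof.
move=> sE; have inj : injective (fun w => [set v; w]).
  move=> w w' /eqP; rewrite set2_eq eqxx /=.
  by case/orP=> [/eqP //|/andP[/eqP<- /eqP->]].
rewrite -(card_imset (nbrs E v) inj) /degree; congr #|pred_of_set _|.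
apply/setP=> e; rewrite inE; apply/imsetP/andP=> [[w wN ->]|[eE ve]].
  by rewrite -in_nbrs wN !inE eqxx.
have [x [y [_ e_xy]]] := simple_edge sE eE; subst e.
move: ve eE; rewrite !inE => /orP[] /eqP-> eE.
  by exists y => //; rewrite in_nbrs.
by exists x; rewrite ?in_nbrs setUC.
Qed.

Lemma card_nbrs_realization pi E v : realization pi E -> #|nbrs E v| = pi v.
Proof. by case/andP=> sE /forallP/(_ v)/eqP <-; rewrite card_nbrs. Qed.

(** Read as a degree condition, being a 1-factor is preserved by swaps for the
same reason as being a realization of any other sequence. *)
Lemma one_factorE I : one_factor I = realization ones I.
Proof.
rewrite /one_factor /realization; case sI: (simple_graph I) => //=.
apply/idP/idP=> [/and3P[/eqP cI tI _]|/forallP dI].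
  apply/forallP=> v; have: v \in cover I by rewrite cI inE.
  case/bigcupP=> e eI ve; apply/cards1P; exists e; apply/setP=> e'.
  rewrite !inE; apply/andP/eqP=> [[e'I ve']|-> //].
  by rewrite -(def_pblock tI e'I ve') (def_pblock tI eI ve).
have dI' v : exists e, [set e in I | v \in e] = [set e] by apply/cards1P; apply: dI.
apply/and3P; split.
- apply/eqP/setP=> v; rewrite inE; apply/bigcupP; have [e] := dI' v.
  by move/setP/(_ e); rewrite !inE eqxx => /andP[eI ve]; exists e.
- apply/trivIsetP=> e f eI fI; apply: contraR => /pred0Pn[v /andP[/= ve vf]].
  have [h hP] := dI' v.
  have /set1P-> : e \in [set h] by rewrite -hP inE eI.
  by rewrite eq_sym -in_set1 -hP inE fI.
- apply/negP=> /(simple_edge (E := I) sI)[u [v [_ /setP/(_ u)]]].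
  by rewrite !inE eqxx.
Qed.

Lemma one_factor_mate I : one_factor I ->
  exists f : 'I_n -> 'I_n,
    [/\ forall u v, ([set u; v] \in I) = (v == f u), involutive f
      & forall u, f u != u].
Proof.
rewrite one_factorE => rI; have sI : simple_graph I by case/andP: rI.
have fP u : exists w, nbrs I u == [set w].
  by have /eqP/cards1P[w ->] := card_nbrs_realization u rI; exists w.
pose f u := xchoose (fP u).
have fE u v : ([set u; v] \in I) = (v == f u).
  by rewrite -in_nbrs (eqP (xchooseP (fP u))) inE.
exists f; split=> // u.
  by apply/esym/eqP; rewrite -fE setUC fE.
by rewrite eq_sym; apply: (edge_neq sI); rewrite fE.
Qed.

(** * Swaps *)

Section SwapTheory.
Variables (a b c d : 'I_n) (E : edges).
Hypothesis sw : swappable a b c d E.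

Lemma swap_uniq : uniq [:: a; b; c; d]. Proof. by case/and5P: sw. Qed.

Lemma swap_sets :
  [/\ [set a; b] != [set c; d], [set b; c] != [set a; d],
      [set [set a; b]; [set c; d]] \subset E
    & [disjoint [set [set b; c]; [set a; d]] & E]].
Proof.
case/and5P: sw => /=; rewrite !inE !negb_or andbT.
case/and3P=> /and3P[ab ac ad] /andP[bc bd] cd abE cdE bcE adE; split.
- by rewrite set2_eq (negbTE ac) (negbTE ad).
- by rewrite set2_eq eq_sym (negbTE ab) (negbTE bd).
- by apply/subsetP=> e /set2P[] ->.
- by rewrite disjoint_subset; apply/subsetP=> e /set2P[] ->; rewrite inE.
Qed.

(** Each of a, b, c, d lies on exactly one removed edge and on exactly one new
edge. *)
Lemma swap_realization pi : realization pi E -> realization pi (swap a b c d E).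
Proof.
case/andP=> /forall_inP sE /forallP dE.
have [ab_cd bc_ad subE disE] := swap_sets.
have := swap_uniq; rewrite /= !inE !negb_or andbT.
case/and3P=> /and3P[ab ac ad] /andP[bc bd] cd.
apply/andP; split.
  apply/forall_inP=> e; rewrite inE => /andP[_ /setUP[/sE //|/set2P[] ->]];
  by rewrite cards2 ?bc ?ad.
apply/forallP=> v; rewrite -(eqP (dE v)); apply/eqP.
(* With degrees written as sums over edges, the common part of the two
   graphs cancels and only the four exchanged edges have to be compared. *)
have degE F : degree F v = \sum_(e in F) (v \in e).
  rewrite /degree -sum1_card big_mkcond [RHS]big_mkcond /=.
  by apply: eq_bigr => e _; rewrite inE; case: (e \in F); case: (v \in e).
rewrite !degE (big_setID [set [set b; c]; [set a; d]]) /=.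
rewrite [RHS](big_setID [set [set a; b]; [set c; d]]) /=.
rewrite (setIidPr subE).
have -> : swap a b c d E :&: [set [set b; c]; [set a; d]]
          = [set [set b; c]; [set a; d]].
  apply/setIidPr; rewrite subsetD subsetUr.
  by apply: disjointWr subE disE.
have -> : swap a b c d E :\: [set [set b; c]; [set a; d]]
          = E :\: [set [set a; b]; [set c; d]].
  apply/setP=> e; rewrite in_setD [e \in swap _ _ _ _ _]in_setD in_setU in_setD.
  case eA: (e \in [set [set b; c]; [set a; d]]); last by rewrite orbF.
  by rewrite (disjointFr disE eA) andbF.
congr (_ + _); rewrite !big_setU1 ?inE ?big_set1 //= !inE.
move: ab ac ad bc bd cd.
case: (v =P a) => [->|_].
  by rewrite ?eqxx; do ![case: (_ == _)].
case: (v =P b) => [->|_]; first by do ![case: (_ == _)].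
case: (v =P c) => [->|_]; first by do ![case: (_ == _)].
by case: (v == d).
Qed.

Lemma swap_inv :
  swappable b c d a (swap a b c d E) && (swap b c d a (swap a b c d E) == E).
Proof.
have [_ _ subE disE] := swap_sets; have inR := subsetP subE.
have notA e : e \in [set [set b; c]; [set a; d]] -> e \notin E.
  by move=> eA; rewrite (disjointFr disE eA).
have R_A e : e \in [set [set a; b]; [set c; d]] ->
    e \notin [set [set b; c]; [set a; d]].
  by move=> /inR; apply: contraL; apply: notA.
apply/andP; split; last first.
  apply/eqP/setP=> e; rewrite /swap [[set d; a]]setUC [[set b; a]]setUC.
  rewrite [[set [set c; d]; _]]setUC !(in_setD, in_setU E) in_setU in_setD.
  rewrite in_setU.
  move/implyP: (notA e); move/implyP: (R_A e); move/implyP: (inR e).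
  by do 3![case: (e \in _) => //=].
have swE e : (e \in swap a b c d E) = (e \notin [set [set a; b]; [set c; d]]) &&
    ((e \in E) || (e \in [set [set b; c]; [set a; d]])).
  by rewrite /swap in_setD in_setU.
rewrite /swappable -(rot_uniq 3) swap_uniq !swE /=.
rewrite [[set d; a]]setUC [[set b; a]]setUC.
rewrite set21 set22 set22 set21 !orbT !andbT /=.
by rewrite !(contraL (@R_A _)) ?set21 ?set22.
Qed.

Lemma swap_new : [set b; c] \in swap a b c d E /\ [set a; d] \in swap a b c d E.
Proof.
by have /andP[/and5P[]] := swap_inv; rewrite [[set d; a]]setUC.
Qed.

Lemma swap_keep u v :
  u \notin [:: a; b; c; d] -> [set u; v] \in E -> [set u; v] \in swap a b c d E.
Proof.
move=> uN uvE; move: uN; rewrite !in_cons !negb_or => /and5P[ua ub uc ud _].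
rewrite /swap in_setD (in_setU _ E) uvE andbT !inE !set2_eq.
by rewrite (negbTE ua) (negbTE ub) (negbTE uc) (negbTE ud).
Qed.

Lemma swap_lost e : e \notin swap a b c d E ->
  [/\ e != [set b; c], e != [set a; d]
    & e \in E -> e = [set a; b] \/ e = [set c; d]].
Proof.
have [bcE' adE'] := swap_new => eE'; split.
- by apply: contraNneq eE' => ->.
- by apply: contraNneq eE' => ->.
move=> eE; apply/set2P; apply: contraNT eE' => eR.
by rewrite /swap in_setD (in_setU _ E) eR eE.
Qed.

End SwapTheory.

(** * Realizations of a degree sequence are joined by swaps *)

Definition swap_step : rel edges := fun E E' =>
  [exists a, exists b, exists c, exists d,
     swappable a b c d E && (E' == swap a b c d E)].

Lemma swap_stepP E E' :
  reflect (exists a b c d, swappable a b c d E /\ E' = swap a b c d E)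
          (swap_step E E').
Proof.
apply: (iffP existsP) => [[a /existsP[b /existsP[c /existsP[d /andP[sw /eqP->]]]]]|].
  by exists a, b, c, d.
move=> [a [b [c [d [sw ->]]]]]; exists a; apply/existsP; exists b.
by apply/existsP; exists c; apply/existsP; exists d; rewrite sw eqxx.
Qed.

Lemma swap_step_at a b c d E : swappable a b c d E -> swap_step E (swap a b c d E).
Proof. by move=> sw; apply/swap_stepP; exists a, b, c, d. Qed.

Lemma swap_step_sym E E' : swap_step E E' -> swap_step E' E.
Proof.
case/swap_stepP=> a [b [c [d [sw ->]]]]; apply/swap_stepP; exists b, c, d, a.
by have /andP[sw' /eqP] := swap_inv sw.
Qed.

Lemma connect_swap_step_sym : connect_sym swap_step.
Proof. by apply: sym_connect_sym => E E'; apply/idP/idP; apply: swap_step_sym. Qed.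

Lemma connect_realization pi E E' :
  connect swap_step E E' -> realization pi E -> realization pi E'.
Proof.
apply: connect_closed => F F' /swap_stepP[a [b [c [d [sw ->]]]]].
exact: swap_realization.
Qed.

Definition distance G G' := #|G :\: G'| + #|G' :\: G|.

(** The path x' - x - y - y' has edges in G only, in G' only, in G only. If the
chord x'y' is not in G, replacing x'x and yy' by xy and x'y' in G gains xy; if
it is in both graphs, the reverse exchange in G' loses xy and x'y' but gains
x'x and yy'. Either way the symmetric difference loses three edges and gains
at most x'y'. The chord in G only is the one case where this fails. *)
Lemma exchange G G' x y x' y' :
    simple_graph G -> simple_graph G' ->
    y \in nbrs G' x :\: nbrs G x -> x' \in nbrs G x :\: nbrs G' x ->
    y' \in nbrs G y :\: nbrs G' y -> x' != y' ->
    x' \notin nbrs G y' :\: nbrs G' y' ->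
  exists H H', [/\ connect swap_step G H, connect swap_step G' H'
                 & distance H H' < distance G G'].
Proof.
move=> sG sG'; rewrite !in_setD !in_nbrs.
move=> /andP[xyG xyG'] /andP[xx'G' xx'G] /andP[yy'G' yy'G] nx'y'.
rewrite [[set y'; x']]setUC negb_and negbK => x'y'.
have nxy := edge_neq sG' xyG'; have nxx' := edge_neq sG xx'G.
have nyy' := edge_neq sG yy'G.
have nx'y : x' != y by apply: contraNneq xyG => <-.
have nxy' : x != y' by apply: contraNneq xyG => ->; rewrite setUC.
have ne : [set x; x'] != [set y; y'].
  by rewrite set2_eq (negbTE nxy) (negbTE nxy').
have [x'y'G|x'y'G] := boolP ([set x'; y'] \in G); last first.
  have sw : swappable x' x y y' G.
    rewrite /swappable [[set x'; x]]setUC xx'G yy'G xyG x'y'G /= !inE.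
    by rewrite !negb_or !andbT eq_sym nxx' nx'y nx'y' nxy nxy' nyy'.
  exists (swap x' x y y' G), G'.
  split; [exact: connect1 (swap_step_at sw)|exact: connect0|].
  rewrite -addSn; apply: leq_add; last first.
    apply/subset_leq_card/subsetP=> e; rewrite !in_setD !in_setU.
    rewrite negb_and negbK !in_set1 negb_or => /andP[/orP[/orP[]/eqP->|]].
    - by rewrite setUC (negbTE xx'G').
    - by rewrite (negbTE yy'G').
    - by case/andP=> ->.
  apply: (@card_exchange _ _ _ [set x; x'] [set y; y'] [set x'; y']) => //.
  - by rewrite in_setD xx'G'.
  - by rewrite in_setD yy'G'.
  apply/subsetP=> e; rewrite /swap !(in_setD, in_setU, in_set1).
  rewrite [[set x'; x]]setUC negb_or.
  case/and3P=> eG' /andP[-> ->] /= /orP[eG|/orP[]/eqP e_xy].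
  - by rewrite eG eG' orbT.
  - by rewrite e_xy xyG' in eG'.
  - by rewrite e_xy eqxx.
rewrite x'y'G orbF in x'y'.
have sw : swappable x y y' x' G'.
  rewrite /swappable [[set y'; x']]setUC xyG' x'y' xx'G' yy'G' /= !inE.
  by rewrite !negb_or !andbT nxy nxy' nxx' nyy' eq_sym nx'y eq_sym nx'y'.
exists G, (swap x y y' x' G').
split; [exact: connect0|exact: connect1 (swap_step_at sw)|].
rewrite -addSn; apply: leq_add; last first.
  apply/subset_leq_card/subsetP=> e; rewrite !in_setD !in_setU !in_set1.
  case/and3P=> eG _ /or3P[->|/eqP e_xy|/eqP e_xy]; first by rewrite eG.
    by rewrite e_xy yy'G in eG.
  by rewrite e_xy xx'G in eG.
apply: (@card_exchange _ _ _ [set x; x'] [set y; y'] [set x'; y']) => //.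
- by rewrite in_setD xx'G'.
- by rewrite in_setD yy'G'.
apply/subsetP=> e; rewrite /swap !(in_setD, in_setU, in_set1).
rewrite [[set y'; x']]setUC negb_and negbK !negb_or.
case/andP=> /orP[/orP[]/eqP->|/and3P[-> -> ->] ->].
- by rewrite (negbTE xyG).
- by rewrite eqxx.
by rewrite orbT.
Qed.

(** If no [exchange] applies, the last vertex of every path x' - x - y - y'
coloured r, b, r has x' as an r-neighbour. So y' inherits all the
r-neighbours of x except perhaps itself, and also has y. When x has maximal
r-degree, y' cannot have more r-neighbours than x, which forces y' to be one
of the r-neighbours of x and to have maximal r-degree too. *)
Lemma max_degree_spreads (T : finType) (r b : T -> {set T}) (x y y' : T) :
    (forall u v : T, (v \in r u) = (u \in r v)) ->
    (forall u : T, [disjoint r u & b u]) ->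
    (forall x y x' y' : T, y \in b x -> x' \in r x -> y' \in r y -> x' != y' ->
       x' \in r y') ->
    (forall v : T, #|r v| <= #|r x|) -> y \in b x -> y' \in r y ->
  y' \in r x /\ forall v : T, #|r v| <= #|r y'|.
Proof.
move=> r_sym rb stuck maxx yb y'r.
have yNr : y \notin r x by rewrite (disjointFl (rb x) yb).
have sub : y |: (r x :\ y') \subset r y'.
  apply/subsetP=> z /setU1P[->|/setD1P[zy' zr]]; first by rewrite r_sym.
  exact: stuck yb zr y'r zy'.
have := subset_leq_card sub; rewrite cardsU1 !inE (negbTE yNr) andbF /=.
have := maxx y'; rewrite (cardsD1 y' (r x)).
case: (y' \in r x) => /=; last by lia.
move=> le1 le2; split=> // v; apply: leq_trans (maxx v) _.
by rewrite (cardsD1 y' (r x)); lia.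
Qed.

Theorem realizations_connected pi G G' :
  realization pi G -> realization pi G' -> connect swap_step G G'.
Proof.
have [m] := ubnP (distance G G'); elim: m G G' => // m IH G G' le_m rG rG'.
have [sG sG'] : simple_graph G /\ simple_graph G'.
  by case/andP: rG => ? _; case/andP: rG' => ? _.
pose r v := nbrs G v :\: nbrs G' v; pose b v := nbrs G' v :\: nbrs G v.
have advance H H' : connect swap_step G H -> connect swap_step G' H' ->
    distance H H' < distance G G' -> connect swap_step G G'.
  move=> GH G'H' lt_d; apply: connect_trans (GH) _.
  apply: connect_trans (_ : connect swap_step H' G'); last first.
    by rewrite connect_swap_step_sym.
  apply: IH; first exact: leq_trans lt_d le_m.
    exact: connect_realization GH rG.
  exact: connect_realization G'H' rG'.
have r_sym u v : (v \in r u) = (u \in r v).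
  by rewrite !in_setD (nbrs_sym G) (nbrs_sym G').
have b_sym u v : (v \in b u) = (u \in b v).
  by rewrite !in_setD (nbrs_sym G) (nbrs_sym G').
have rb u : [disjoint r u & b u].
  rewrite disjoint_subset; apply/subsetP=> v.
  by rewrite !inE negb_and negbK => /andP[_ ->].
have card_rb v : #|r v| = #|b v|.
  have := cardsID (nbrs G' v) (nbrs G v); have := cardsID (nbrs G v) (nbrs G' v).
  rewrite (card_nbrs_realization v rG) (card_nbrs_realization v rG') -/(r v) -/(b v).
  by rewrite setIC; lia.
have [//|nGG'] := boolP (connect swap_step G G').
have stuck_r x y x' y' : y \in b x -> x' \in r x -> y' \in r y -> x' != y' ->
    x' \in r y'.
  move=> yb xr yr nxy; apply: contraNT nGG' => xNr.
  by have [H [H' [GH GH' lt_d]]] := exchange sG sG' yb xr yr nxy xNr;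
    apply: advance lt_d.
have stuck_b x y x' y' : y \in r x -> x' \in b x -> y' \in b y -> x' != y' ->
    x' \in b y'.
  move=> yb xr yr nxy; apply: contraNT nGG' => xNr.
  have [H [H' [GH GH' lt_d]]] := exchange sG' sG yb xr yr nxy xNr.
  by apply: advance GH' GH _; rewrite /distance addnC [ltnRHS]addnC.
have [r0|[v0 v0r]] : (forall v, r v = set0) \/ exists v, r v != set0.
  have [/existsP|/existsPn r0] := boolP [exists v, r v != set0]; first by right.
  by left=> v; apply/eqP; rewrite -[_ == _]negbK.
  case/negP: nGG'; rewrite (_ : G = G') //; apply: simple_ext => // v.
  apply/eqP; rewrite eqEsubset -!setD_eq0 -/(r v) -/(b v) r0 eqxx.
  by rewrite -cards_eq0 -card_rb r0 cards0.
pose x := [arg max_(x > v0) #|r x|].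
have maxx v : #|r v| <= #|r x| by rewrite /x; case: arg_maxnP => // i _; apply.
have /card_gt0P[y yb] : 0 < #|b x|.
  by rewrite -card_rb (leq_trans _ (maxx v0)) // card_gt0.
have /card_gt0P[y' y'r] : 0 < #|r y|.
  by rewrite card_rb; apply/card_gt0P; exists x; rewrite b_sym.
have [y'rx maxy'] := max_degree_spreads r_sym rb stuck_r maxx yb y'r.
(* Exchanging the colours, y' is a vertex of maximal b-degree, and the path
   y' - y - x coloured r, b makes x a b-neighbour of y'; but x is an
   r-neighbour of y'. *)
have [] := @max_degree_spreads _ b r y' y x b_sym _ stuck_b _ _ _.
- by move=> u; rewrite disjoint_sym.
- by move=> v; rewrite -!card_rb.
- by rewrite r_sym.
- by rewrite b_sym.
by rewrite b_sym (disjointFr (rb x) y'rx).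
Qed.

(** * K-swaps *)

Lemma disjoint_swap a b c d E (F : edges) :
  [disjoint E & F] -> [set b; c] \notin F -> [set a; d] \notin F ->
  [disjoint swap a b c d E & F].
Proof.
move=> disEF bc ad; rewrite disjoints_subset; apply/subsetP=> e.
rewrite in_setD in_setU => /andP[_ /orP[eE|/set2P[] ->]]; rewrite in_setC //.
by rewrite (disjointFr disEF eE).
Qed.

Lemma kswap_kundu (pi : 'I_n -> nat) K K' :
  kswap K K' -> kundu_realization pi K -> kundu_realization pi K'.
Proof.
case: K => G I /existsP[a /existsP[b /existsP[c /existsP[d]]]].
case/andP=> /and5P[un /= ab cd bc ad] stp /and3P[/= rG fI disGI].
have nG e : e \notin G :|: I -> e \notin G /\ e \notin I.
  by rewrite in_setU negb_or => /andP.
have [[bcG bcI] [adG adI]] := (nG _ bc, nG _ ad).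
case/orP: stp => /andP[R /eqP->]; apply/and3P; split=> //=.
- rewrite one_factorE; rewrite one_factorE in fI; apply: swap_realization fI.
  by rewrite /swappable un bcI adI !(subsetP R) ?set21 ?set22.
- by rewrite disjoint_sym disjoint_swap // disjoint_sym.
- apply: swap_realization rG; rewrite /swappable un bcG adG /= !andbT.
  move: ab cd; rewrite !in_setU.
  by rewrite !(disjointFr R) ?set21 ?set22 // !orbF => -> ->.
- exact: disjoint_swap.
Qed.

Lemma connect_kundu (pi : 'I_n -> nat) K K' :
  connect (@kswap n) K K' -> kundu_realization pi K -> kundu_realization pi K'.
Proof. by apply: connect_closed; apply: kswap_kundu. Qed.

(** In a 1-factor the new edges cannot be present already, as their ends have
other partners; only G can obstruct the swap. *)
Lemma kswap_matching pi G I a b c d :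
    kundu_realization pi (G, I) -> uniq [:: a; b; c; d] ->
    [set a; b] \in I -> [set c; d] \in I ->
    [set b; c] \notin G -> [set a; d] \notin G ->
  [/\ connect (@kswap n) (G, I) (G, swap a b c d I),
      kundu_realization pi (G, swap a b c d I) & swappable a b c d I].
Proof.
move=> KI un ab cd bcG adG.
have [_ /= /one_factor_mate[f [If _ _]] _] := and3P KI.
have [bcI adI] : [set b; c] \notin I /\ [set a; d] \notin I.
  have def_a : a = f b by apply/eqP; rewrite -If setUC.
  have def_b : b = f a by apply/eqP; rewrite -If.
  move: un; rewrite !If -def_a -def_b /= !inE !negb_or.
  by case/and4P=> /and3P[_ ac _] /andP[_ bd] _ _; rewrite eq_sym ac eq_sym.
have sw : swappable a b c d I by rewrite /swappable un ab cd bcI.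
have stp : kswap (G, I) (G, swap a b c d I).
  apply/existsP; exists a; apply/existsP; exists b.
  apply/existsP; exists c; apply/existsP; exists d.
  have [_ _ subR _] := swap_sets sw.
  rewrite /kswap_at /swappable un !in_setU ab cd !orbT !negb_or bcG bcI adG adI /=.
  by rewrite subR eqxx.
by split=> //; [apply: connect1|apply: kswap_kundu KI].
Qed.

Lemma kswap_graph G I a b c d :
    [disjoint G & I] -> swappable a b c d G ->
    [set b; c] \notin I -> [set a; d] \notin I ->
  kswap (G, I) (swap a b c d G, I).
Proof.
move=> disGI sw bcI adI; apply/existsP; exists a; apply/existsP; exists b.
apply/existsP; exists c; apply/existsP; exists d.
have [_ _ subR _] := swap_sets sw; case/and5P: sw => un ab cd bc ad.
rewrite /kswap_at /swappable un !in_setU ab cd !negb_or bcI bc adI ad /=.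
by rewrite (disjointWl subR disGI) eqxx orbT.
Qed.

(** The forbidden vertices number at most n / 6 + 6, which is less than n. *)
Lemma exists_avoiding (A B C D : {set 'I_n}) (s : seq 'I_n) :
    24 <= n -> 24 * #|A| <= n -> 24 * #|B| <= n -> 24 * #|C| <= n ->
    24 * #|D| <= n -> size s <= 6 ->
  exists z, [/\ z \notin A, z \notin B, z \notin C, z \notin D & z \notin s].
Proof.
move=> n24 leA leB leC leD les.
pose X := A :|: B :|: C :|: D :|: [set x in s].
have /card_gt0P[z] : 0 < #|~: X|.
  have leX : #|X| <= #|A| + #|B| + #|C| + #|D| + #|[set x in s]|.
    by do 4!rewrite (leq_trans (leq_card_setU _ _)) ?leq_add2r //.
  have leS : #|[set x in s]| <= size s by rewrite cardsE card_size.
  by move: (cardsC X); rewrite card_ord; lia.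
rewrite !inE !negb_or -!andbA => /and5P[] *; by exists z.
Qed.

(** * Moving the displayed 1-factor *)

Section SmallDegrees.
Variable pi : 'I_n -> nat.
Hypothesis pi_small : forall i : 'I_n, 24 * pi i <= n.

(** Edges shared with G' are removed one at a time: swapping pq and wz for qw
and pz removes one and creates none, provided that z is not joined to p, nor
its partner w to q, in G or in G'. *)
Lemma avoid_graph G G' I :
    kundu_realization pi (G, I) -> realization pi G' ->
  exists2 I', connect (@kswap n) (G, I) (G, I') & [disjoint I' & G :|: G'].
Proof.
have [m] := ubnP #|I :&: (G :|: G')|; elim: m I => // m IH I le_m KI rG'.
have [|/pred0Pn[e /andP[/= eI eGG']]] := boolP [disjoint I & G :|: G'].
  by exists I; first exact: connect0.
have [rG fI disGI] := and3P KI; rewrite /= in rG fI disGI.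
have [f [If ff fx]] := one_factor_mate fI.
have [p [q [npq e_pq]]] : exists p q, p != q /\ e = [set p; q].
  by apply: (simple_edge _ eI); case/andP: fI.
subst e; have def_q : q = f p by apply/eqP; rewrite -If.
(* An edge of a realization makes some degree positive, which excludes
   small n. *)
have n24 : 24 <= n.
  apply: leq_trans (pi_small p); rewrite leq_pmulr //.
  have [H rH pqH] : exists2 H, realization pi H & [set p; f p] \in H.
    by rewrite -def_q; case/setUP: eGG' => ?; [exists G|exists G'].
  rewrite -(card_nbrs_realization p rH) card_gt0; apply/set0Pn.
  by exists (f p); rewrite in_nbrs.
have small H v : realization pi H -> 24 * #|nbrs H v| <= n.
  by move=> rH; rewrite (card_nbrs_realization v rH).
have smallf H v : realization pi H -> 24 * #|f @: nbrs H v| <= n.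
  by move=> rH; rewrite card_imset ?small //; apply: can_inj ff.
have [z] := exists_avoiding n24 (small G p rG) (small G' p rG') (smallf G q rG)
  (smallf G' q rG') (isT : size [:: p; q] <= 6).
(* As f is an involution, z is outside the image of N(q) under f exactly when
   f z, the partner of z, is outside N(q). *)
rewrite -[in z \notin f @: nbrs G q](ff z) -[in z \notin f @: nbrs G' q](ff z).
rewrite !mem_imset ?in_nbrs; try exact: can_inj ff.
rewrite !inE negb_or => -[pzG pzG' qwG qwG' /andP[nzp nzq]].
have nwp : f z != p by rewrite -(inj_eq (can_inj ff)) ff -def_q.
have nwq : f z != q by rewrite def_q (inj_eq (can_inj ff)).
have un : uniq [:: p; q; f z; z].
  by rewrite /= !inE !negb_or npq ![p == _]eq_sym ![q == _]eq_sym nwp nzp nwq nzq fx.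
have wzI : [set f z; z] \in I by rewrite If ff.
have [stp KI' _] := kswap_matching KI un eI wzI qwG pzG.
have [|I' conn dis] := IH _ _ KI' rG'; last first.
  by exists I' => //; apply: connect_trans stp conn.
apply: leq_trans (_ : #|I :&: (G :|: G')| <= m) => //.
apply/proper_card/properP; split; last first.
  by exists [set p; q]; rewrite in_setI ?eI // /swap in_setD set21.
apply/subsetP=> h; rewrite !in_setI /swap in_setD (in_setU h I).
case/andP=> /andP[_ /orP[-> //|/set2P[] ->]]; rewrite in_setU.
  by rewrite (negbTE qwG) (negbTE qwG').
by rewrite (negbTE pzG) (negbTE pzG').
Qed.

(** When x'y' is an edge of G, take u the partner of y' in J and u' the partner
of u in I, so that the alternating path x' - x - y - y' - u - u' has its edges
in I, J, I, J, I. For an edge zw of I far away, the swaps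
  x'x, zw => xz, x'w;   zx, yy' => xy, zy';   zy', uu' => y'u, zu'
trade four edges of I, of which only zw can be in J, for four edges including
xy and y'u, which are in J. *)
Lemma matchings_connected G I J :
    kundu_realization pi (G, I) -> kundu_realization pi (G, J) ->
  connect (@kswap n) (G, I) (G, J).
Proof.
move=> KI KJ; have [m] := ubnP #|J :\: I|; elim: m I KI => // m IH I KI le_m.
have advance I' : connect (@kswap n) (G, I) (G, I') ->
    kundu_realization pi (G, I') -> #|J :\: I'| < #|J :\: I| ->
    connect (@kswap n) (G, I) (G, J).
  move=> II' KI' lt_d; apply: connect_trans II' _; apply: IH => //.
  exact: leq_trans lt_d le_m.
have [rG fI disGI] := and3P KI; have [_ fJ disGJ] := and3P KJ.
rewrite /= in rG fI disGI fJ disGJ.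
have [f [If ff fx]] := one_factor_mate fI.
have [g [Jg gg gx]] := one_factor_mate fJ.
have [/eqP|/set0Pn[e /setDP[eJ eI]]] := boolP (J :\: I == set0).
  move/eqP; rewrite setD_eq0 => JI; rewrite (_ : I = J) ?connect0 //.
  apply: simple_ext; [by case/andP: fI|by case/andP: fJ|move=> u].
  apply/setP=> v; rewrite !in_nbrs If Jg; congr (_ == _); apply/esym/eqP.
  by rewrite -If (subsetP JI) // Jg.
have [x [y [nxy e_xy]]] : exists x y, x != y /\ e = [set x; y].
  by apply: (simple_edge _ eJ); case/andP: fJ.
subst e; rewrite Jg in eJ; have {eJ} def_y := eqP eJ.
have gy : g y = x by rewrite def_y gg.
have finj := can_inj ff; have ginj := can_inj gg.
set x' := f x; set y' := f y.
have xx'I : [set x'; x] \in I by rewrite If ff.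
have yy'I : [set y; y'] \in I by rewrite If.
have nyx' : y != x' by rewrite -If.
have ny'x : y' != x by rewrite -(inj_eq finj) ff.
have nx'y' : x' != y' by rewrite (inj_eq finj).
have nx'x : x' != x by apply: fx.
have ny'y : y' != y by apply: fx.
have xyG : [set x; y] \notin G by rewrite (disjointFl disGJ) // Jg def_y.
have [x'y'G|x'y'G] := boolP ([set x'; y'] \in G); last first.
  have un : uniq [:: x'; x; y; y'].
    rewrite /= !inE !negb_or nx'x [x' == y]eq_sym nyx' nx'y' nxy.
    by rewrite ![_ == y']eq_sym ny'x ny'y.
  have [stp KI' sw] := kswap_matching KI un xx'I yy'I xyG x'y'G.
  apply: advance stp KI' _; apply/proper_card/properP; split; last first.
    exists [set x; y]; first by rewrite in_setD eI Jg def_y eqxx.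
    by rewrite in_setD (proj1 (swap_new sw)).
  apply/subsetP=> h /setDP[hJ /(swap_lost sw)[_ _ hI]].
  rewrite in_setD hJ andbT; apply/negP=> /hI[] h_def; move: hJ; rewrite h_def Jg.
    by rewrite -(inj_eq ginj) gg -def_y (negbTE nyx').
  by rewrite gy (negbTE ny'x).
(* The edge x'y' makes some degree positive, which excludes small n. *)
have n24 : 24 <= n.
  apply: leq_trans (pi_small x'); rewrite leq_pmulr //.
  rewrite -(card_nbrs_realization x' rG) card_gt0; apply/set0Pn.
  by exists y'; rewrite in_nbrs.
set u := g y'; set u' := f u.
have guy' : g u = y' by rewrite /u gg.
have nux : u != x by rewrite -(inj_eq ginj) guy' -def_y.
have nuy : u != y by rewrite -(inj_eq ginj) guy' gy.
have nuy' : u != y' by apply: gx.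
(* If u were x', then x'y' would be an edge of J, and J avoids G. *)
have nux' : u != x'.
  apply: contraTneq x'y'G => <-; rewrite (disjointFl disGJ) //.
  by rewrite setUC Jg.
have nu'u : u' != u by apply: fx.
have uu'I : [set u; u'] \in I by rewrite If.
have nu'y' : u' != y' by rewrite (inj_eq finj).
have small v : 24 * #|nbrs G v| <= n by rewrite (card_nbrs_realization v rG).
have smallf v : 24 * #|f @: nbrs G v| <= n by rewrite card_imset.
have [z] := exists_avoiding n24 (small x) (small y') (small u') (smallf x')
  (isT : size [:: x; x'; y; y'; u; u'] <= 6).
rewrite -[in z \notin f @: _](ff z) mem_imset // !in_nbrs; set w := f z.
rewrite !inE !negb_or => -[xzG y'zG u'zG x'wG].
case/and5P=> nzx nzx' nzy nzy' /andP[nzu nzu'].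
have zwI : [set z; w] \in I by rewrite If.
have nwz : w != z by apply: fx.
have nwx : w != x by rewrite -(inj_eq finj) ff.
have nwx' : w != x' by rewrite (inj_eq finj).
have nwy : w != y by rewrite -(inj_eq finj) ff.
have nwu : w != u by rewrite -(inj_eq finj) ff.
have un1 : uniq [:: x'; x; z; w].
  rewrite /= !inE !negb_or nx'x ![_ == z]eq_sym ![_ == w]eq_sym.
  by rewrite nzx nzx' nwx nwx' nwz.
have [stp1 KI1 sw1] := kswap_matching KI un1 xx'I zwI xzG x'wG.
set I1 := swap x' x z w I in stp1 KI1.
have zxI1 : [set z; x] \in I1 by rewrite setUC (proj1 (swap_new sw1)).
have yy'I1 : [set y; y'] \in I1.
  apply: swap_keep => //.
  by rewrite !inE !negb_or nyx' ![y == _]eq_sym nxy nzy nwy.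
have uu'I1 : [set u; u'] \in I1.
  apply: swap_keep => //.
  by rewrite !inE !negb_or nux nux' [u == z]eq_sym nzu eq_sym.
have un2 : uniq [:: z; x; y; y'].
  by rewrite /= !inE !negb_or nzx nzy nzy' nxy ![_ == y']eq_sym ny'x ny'y.
rewrite setUC in y'zG.
have [stp2 KI2 sw2] := kswap_matching KI1 un2 zxI1 yy'I1 xyG y'zG.
set I2 := swap z x y y' I1 in stp2 KI2.
have zy'I2 : [set z; y'] \in I2 by have [] := swap_new sw2.
have uu'I2 : [set u; u'] \in I2.
  by apply: swap_keep => //; rewrite !inE !negb_or nux nuy nuy' eq_sym nzu.
have un3 : uniq [:: z; y'; u; u'].
  by rewrite /= !inE !negb_or nzy' nzu nzu' ![y' == _]eq_sym nuy' nu'y' eq_sym nu'u.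
have y'uJ : [set y'; u] \in J by rewrite Jg.
have y'uG : [set y'; u] \notin G by rewrite (disjointFl disGJ).
rewrite setUC in u'zG.
have [stp3 KI3 sw3] := kswap_matching KI2 un3 zy'I2 uu'I2 y'uG u'zG.
apply: (advance _ (connect_trans stp1 (connect_trans stp2 stp3))) => //.
apply: (@card_exchange _ _ _ [set x; y] [set y'; u] [set z; w]).
- by rewrite in_setD eI Jg def_y eqxx.
- by rewrite in_setD y'uJ If ff nuy.
- by rewrite set2_eq ![x == _]eq_sym (negbTE ny'x) (negbTE nux).
apply/subsetP=> h /setDP[hJ /(swap_lost sw3)[h_y'u _ hI2]].
have {}hI2 : h \notin I2.
  apply/negP=> /hI2[] h_def; move: hJ; rewrite h_def Jg -(inj_eq ginj) gg.
    by rewrite eq_sym (negbTE nzu).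
  by rewrite -(inj_eq ginj) gg guy' (negbTE nu'y').
have [h_xy _ hI1] := swap_lost sw2 hI2.
have {}hI1 : h \notin I1.
  apply/negP=> /hI1[] h_def; move: hJ; rewrite h_def Jg -(inj_eq ginj) gg.
    by rewrite -def_y eq_sym (negbTE nzy).
  by rewrite -(inj_eq ginj) gg gy (negbTE ny'x).
have [_ _ hI] := swap_lost sw1 hI1.
rewrite in_setU1 !in_setD !in_set1 h_xy h_y'u hJ andbT /=.
have [/hI[]|_] := boolP (h \in I); rewrite ?orbT // => h_def.
  move: hJ; rewrite h_def Jg -(inj_eq ginj) gg -def_y.
  by rewrite (negbTE nyx').
by rewrite h_def eqxx.
Qed.

(** Each swap on the way from G to G' is preceded by moving the 1-factor off the
next graph, and the 1-factor is adjusted to J at the end. *)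
Lemma kundu_connected G I G' J :
    kundu_realization pi (G, I) -> kundu_realization pi (G', J) ->
  connect (@kswap n) (G, I) (G', J).
Proof.
move=> KGI KGJ; have [[rG _ _] [rG' _ _]] := (and3P KGI, and3P KGJ).
rewrite /= in rG rG'.
have /connectP[s] := realizations_connected rG rG'.
elim: s G I KGI rG => [|G1 s IH] G I KGI rG /=.
  by move=> _ def_G'; subst G'; apply: matchings_connected.
case/andP=> /swap_stepP[a [b [c [d [sw def_G1]]]]] path_s last_s.
have rG1 : realization pi G1 by rewrite def_G1; apply: swap_realization.
have [I1 stp dis] := avoid_graph KGI rG1.
have KGI1 := connect_kundu stp KGI.
have nI1 h : h \in G1 -> h \notin I1.
  by move=> hG1; rewrite (disjointFl dis) // in_setU hG1 orbT.
have [bcG1 adG1] := swap_new sw; rewrite -def_G1 in bcG1 adG1.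
have [_ _ /= disGI1] := and3P KGI1.
have stp1 := kswap_graph disGI1 sw (nI1 _ bcG1) (nI1 _ adG1).
rewrite -def_G1 in stp1.
apply: connect_trans stp (connect_trans (connect1 stp1) _).
exact: IH (kswap_kundu stp1 KGI1) rG1 path_s last_s.
Qed.

End SmallDegrees.
End Graphs.

Theorem theorem1p5 (n : nat) (pi : 'I_n -> nat)
    (pi_graphic : graphic pi)
    (pi_small : forall i : 'I_n, 24 * pi i <= n)
    (pi1_graphic : graphic (add_seq pi ones))
    (G I G' J : {set {set 'I_n}})
    (KGI : kundu_realization pi (G, I))
    (KGJ : kundu_realization pi (G', J)) :
  exists s : seq ({set {set 'I_n}} * {set {set 'I_n}}),
    [/\ path (@kswap n) (G, I) s,
        all (kundu_realization pi) s
      & last (G, I) s = (G', J)].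
Proof.
have /connectP[s path_s last_s] := kundu_connected pi_small KGI KGJ.
exists s; split=> //; move: KGI path_s {last_s}.
elim: s (G, I) => //= K' s IH K KK /andP[stp path_s].
by have KK' := kswap_kundu stp KK; rewrite KK' (IH K').
Qed.
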